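(* Let $G=(V,E)$ be a finite graph and $\Gamma$ a non-empty, non-trivial finite family of objects on $G$. Fix $1<p<\infty$. For $\sigma\in\mathbb{R}_{>0}^E$ let $\rho^*_\sigma$ be the extremal density for $\operatorname{Mod}_{p,\sigma}(\Gamma)$, and let $$\eta^*_\sigma(e):=\frac{\sigma(e)\,\rho^*_\sigma(e)^{p-1}}{\operatorname{Mod}_{p,\sigma}(\Gamma)},\qquad e\in E.$$ Then, for each $e\in E$, as functions of the variable $\sigma(e)\in(0,\infty)$ (with the other weights $\sigma(e')$, $e'\ne e$, held fixed): (a) $\operatorname{Mod}_{p,\sigma}(\Gamma)$ is weakly increasing; (b) $\rho^*_\sigma(e)$ is weakly decreasing; (c) $\eta^*_\sigma(e)$ is weakly increasing.
   Context: A finite family of objects $\Gamma$ on a finite graph $G=(V,E)$ is a finite set together with a usage matrix $\mathcal N\in\mathbb{R}_{\ge0}^{\Gamma\times E}$; $\mathcal N(\gamma,e)$ is the usage of edge $e$ by the object $\gamma$. The family is non-trivial if $\Gamma\neq\varnothing$ and each $\gamma\in\Gamma$ has $\mathcal N(\gamma,e)>0$ for at least one $e\in E$. The admissible set is $\operatorname{Adm}(\Gamma):=\{\rho\in\mathbb{R}_{\ge0}^E:\ \sum_{e\in E}\mathcal N(\gamma,e)\rho(e)\ge1\ \text{for all }\gamma\in\Gamma\}$. For $1\le p<\infty$ and $\sigma\in\mathbb{R}_{>0}^E$, $\operatorname{Mod}_{p,\sigma}(\Gamma):=\inf_{\rho\in\operatorname{Adm}(\Gamma)}\sum_{e\in E}\sigma(e)\rho(e)^p$.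 For $1<p<\infty$ there is a unique $\rho\in\operatorname{Adm}(\Gamma)$ attaining the infimum; it is called the extremal density. *)

(* Defs.v *)
From HB Require Import structures.
From mathcomp Require Import all_boot all_order all_algebra.
From mathcomp Require Import all_classical all_reals all_analysis.

Set Implicit Arguments.
Unset Strict Implicit.
Unset Printing Implicit Defensive.

Import Order.TTheory GRing.Theory Num.Theory.

Local Open Scope classical_set_scope.
Local Open Scope ring_scope.

(* Loops and parallel edges are allowed: an edge is incident to the one or two
   vertices of [endpoints]. *)
Record fin_graph := FinGraph {
  vertex : finType;
  edge : finType;
  endpoints : edge -> {set vertex};
  endpoints_card : forall e, (1 <= #|endpoints e| <= 2)%N }.

Record object_family (R : realType) (G : fin_graph) := ObjectFamily {
  object : finType;
  usage : object -> edge G -> R;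
  usage_ge0 : forall gamma e, 0 <= usage gamma e }.

Definition nontrivial (R : realType) (G : fin_graph)
    (Gamma : object_family R G) : Prop :=
  (0 < #|object Gamma|)%N /\
  forall gamma : object Gamma, exists e : edge G, 0 < usage gamma e.

Definition Adm (R : realType) (G : fin_graph) (Gamma : object_family R G) :
    set (edge G -> R) :=
  [set rho | (forall e, 0 <= rho e) /\
             forall gamma : object Gamma, 1 <= \sum_e usage gamma e * rho e].

Definition energy (R : realType) (G : fin_graph) (p : R)
    (sigma rho : edge G -> R) : R :=
  \sum_e sigma e * (rho e `^ p).

(* [inf] is the real infimum, with value 0 on the empty set; [Adm Gamma] is
   nonempty when [Gamma] is nontrivial, and the energies are bounded below by 0
   when [sigma] is positive. *)
Definition Mod (R : realType) (G : fin_graph) (p : R) (sigma : edge G -> R)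
    (Gamma : object_family R G) : R :=
  inf [set energy p sigma rho | rho in Adm Gamma].

Definition is_extremal (R : realType) (G : fin_graph) (p : R)
    (sigma : edge G -> R) (Gamma : object_family R G) (rho : edge G -> R) :
    Prop :=
  Adm Gamma rho /\ energy p sigma rho = Mod p sigma Gamma.

(* For [1 < p], positive [sigma] and nontrivial [Gamma] there is exactly one
   extremal density; the default value 0 is then not used. *)
Definition extremal_density (R : realType) (G : fin_graph) (p : R)
    (sigma : edge G -> R) (Gamma : object_family R G) : edge G -> R :=
  xget (fun=> 0) [set rho | is_extremal p sigma Gamma rho].

Definition eta_star (R : realType) (G : fin_graph) (p : R)
    (sigma : edge G -> R) (Gamma : object_family R G) (e : edge G) : R :=
  sigma e * (extremal_density p sigma Gamma e `^ (p - 1)) / Mod p sigma Gamma.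

Definition set_weight (R : realType) (G : fin_graph) (sigma : edge G -> R)
    (e : edge G) (t : R) : edge G -> R :=
  fun e' => if e' == e then t else sigma e'.

(* Main.v *)
Require Import Defs.
From HB Require Import structures.
From mathcomp Require Import all_boot all_order all_algebra.
From mathcomp Require Import all_classical all_reals all_analysis.
From mathcomp Require Import ring lra.

Set Implicit Arguments.
Unset Strict Implicit.
Unset Printing Implicit Defensive.

Import Order.TTheory GRing.Theory Num.Theory.
Import numFieldNormedType.Exports.

(** Part (a) holds because the energy of each admissible density increases with
the weights.

For part (b), an extremal density for one weight is a competitor for the other.
Adding the two minimality inequalities gives
  sum_e (sigma2 e - sigma1 e) (rho2 e ^ p - rho1 e ^ p) <= 0
([extremal_power_antimonotone]); when the weights differ on one edge only, a
single term is left and its sign is the claim.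

Part (c) is the same argument for the dual density eta.  Perturbing an extremal
rho towards an admissible rho' gives the first-order condition
[extremal_first_order], which says that sum_e eta e * rho' e >= 1, with equality
at rho' = rho: eta is admissible for the blocking family.  Testing each of
eta1, eta2 against the other extremal density, and adding with positive weights
c1, c2, gives
  0 <= sum_e (eta1 e - eta2 e) (c2 rho2 e - c1 rho1 e)
([dual_density_cross]).  The weight c = Mod ^ (- 1 / (p - 1)) turns the
definition of eta into eta e = sigma e * (c * rho e) ^ (p - 1)
([dual_densityE]), in which the modulus no longer appears.  So on an edge whose
weight does not change, eta is an increasing function of c * rho and the
corresponding term is nonpositive.  The term of the remaining edge is therefore
nonnegative, which forbids eta to decrease there while sigma increases.

The extremal densities exist because the admissible densities of energy at most
that of a given one lie in a box, whose admissible part is compact, and the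
energy is continuous on it ([is_extremal_exists]). *)

Local Open Scope ring_scope.

(** * Real powers *)

(** The norm is needed because the power of a negative number is 1 by
convention, so that the power function itself is not continuous at 0. *)
Lemma continuous_norm_powR (R : realType) (r : R) : 0 < r ->
  continuous (fun x : R => `|x| `^ r).
Proof.
move=> r_gt0 x; have [->|x_neq0] := eqVneq x 0.
  rewrite /continuous_at normr0 powR0 ?gt_eqF//.
  apply/cvgrPdist_lt => eps eps_gt0.
  have delta_gt0 : 0 < eps `^ r^-1 by exact: powR_gt0.
  apply: filterS (@nbhs0_lt _ R _ delta_gt0) => y y_lt.
  rewrite sub0r normrN ger0_norm ?powR_ge0//.
  rewrite -[ltRHS](@powRr1 _ eps) ?ltW// -(@mulVf _ r) ?gt_eqF// powRrM.
  by apply: gt0_ltr_powR => //; rewrite ?nnegrE ?powR_ge0.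
apply: (@continuous_comp _ _ _ (fun y : R => `|y|) (fun y : R => y `^ r)).
  exact: norm_continuous.
apply: differentiable_continuous; apply/derivable1_diffP.
by apply: derivable_powR; rewrite in_itv/= andbT normr_gt0.
Qed.

(** The graph of the convex function x ^ p lies above its tangent at b.  This is
Young's inequality for a and b ^ (p - 1), which also covers b = 0. *)
Lemma powR_tangent (R : realType) (p a b : R) : 1 < p -> 0 <= a -> 0 <= b ->
  p * (b `^ (p - 1) * (a - b)) <= a `^ p - b `^ p.
Proof.
move=> p_gt1 a_ge0 b_ge0.
have p_gt0 : 0 < p by lra.
have q_gt0 : 0 < p / (p - 1) by rewrite divr_gt0//; lra.
have pqE : p^-1 + (p / (p - 1))^-1 = 1.
  by field; rewrite !gt_eqF//; lra.
have := conjugate_powR a_ge0 (powR_ge0 b (p - 1)) p_gt0 q_gt0 pqE.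
rewrite -powRrM (_ : (p - 1) * (p / (p - 1)) = p); last first.
  by field; rewrite gt_eqF//; lra.
have -> : a `^ p / p + b `^ p / (p / (p - 1)) =
    (a `^ p + (p - 1) * b `^ p) / p.
  by field; rewrite !gt_eqF//; lra.
rewrite ler_pdivlMr// mulrBr (mulrC _ b) mulr_powRB1// => young.
lra.
Qed.

Lemma continuous_linear_combination (R : realType) (T : topologicalType)
    (I : finType) (c : I -> R) (F : I -> T -> R) :
  (forall i, continuous (F i)) -> continuous (fun x => \sum_i c i * F i x).
Proof.
move=> F_cont.
have add_cont : continuous (fun z : R * R => z.1 + z.2).
  exact: (@pseudometric_normed_Zmodule.add_continuous R R).
apply: (continuous_big add_cont) => i _ x.
by apply: cvgM; [exact: cvg_cst|exact: F_cont].
Qed.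

(** * Modulus and extremal densities *)

Section Modulus.
Context (R : realType) (G : fin_graph) (Gamma : object_family R G) (p : R).
Implicit Types (sigma rho : edge G -> R).
Local Open Scope classical_set_scope.
Local Open Scope ring_scope.

Lemma energy_ge0 sigma rho : (forall e, 0 < sigma e) -> 0 <= energy p sigma rho.
Proof.
by move=> sigma_gt0; apply: sumr_ge0 => e _; rewrite mulr_ge0 ?powR_ge0 ?ltW.
Qed.

Lemma Mod_le_energy sigma rho : (forall e, 0 < sigma e) ->
  Adm Gamma rho -> Mod p sigma Gamma <= energy p sigma rho.
Proof.
move=> sigma_gt0 rho_adm; apply: ge_inf; last by exists rho.
by exists 0 => _ [rho' _ <-]; exact: energy_ge0.
Qed.

Lemma Adm_neq0 : nontrivial Gamma -> exists rho, Adm Gamma rho.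
Proof.
move=> [_ Gamma_usage].
pose total (gamma : object Gamma) := \sum_e usage gamma e.
have total_gt0 gamma : 0 < total gamma.
  have [e usage_gt0] := Gamma_usage gamma.
  rewrite /total (bigD1 e)//= ltr_pwDl// sumr_ge0// => e' _.
  exact: usage_ge0.
exists (fun=> \sum_gamma (total gamma)^-1); split=> [e|gamma].
  by apply: sumr_ge0 => gamma _; rewrite invr_ge0 ltW.
rewrite -mulr_suml -/(total gamma) mulrC -ler_pdivrMr// div1r.
rewrite (bigD1 gamma)//= lerDl sumr_ge0// => gamma' _.
by rewrite invr_ge0 ltW.
Qed.

Lemma Adm_convex rho rho' s : 0 <= s <= 1 -> Adm Gamma rho -> Adm Gamma rho' ->
  Adm Gamma (fun e => rho e + s * (rho' e - rho e)).
Proof.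
move=> /andP[s_ge0 s_le1] [rho_ge0 rho_len] [rho'_ge0 rho'_len].
split=> [e|gamma].
  by have := rho_ge0 e; have := rho'_ge0 e; nra.
have -> : \sum_e usage gamma e * (rho e + s * (rho' e - rho e)) =
    (1 - s) * (\sum_e usage gamma e * rho e) +
    s * (\sum_e usage gamma e * rho' e).
  by rewrite !mulr_sumr -big_split/=; apply: eq_bigr => e _; ring.
by have := rho_len gamma; have := rho'_len gamma; nra.
Qed.

Lemma closed_length_ge1 (gamma : object Gamma) :
  closed [set rho : prod_topology (fun=> R : topologicalType) |
    1 <= \sum_e usage gamma e * rho e].
Proof.
apply: (@preimage_closed _ _
  (fun rho : prod_topology (fun=> R : topologicalType) =>
     \sum_e usage gamma e * rho e) [set x : R | 1 <= x]); last exact: closed_ge.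
move=> rho _; apply: continuous_linear_combination => e.
exact: proj_continuous.
Qed.

(** The infimum may be taken over the densities in a box: the energy of rho is at
least sigma e * rho e ^ p, which bounds each coordinate of a density that does
better than a fixed admissible rho0.  The box is compact by Tychonoff's
theorem. *)
Lemma is_extremal_exists sigma : nontrivial Gamma -> 0 < p ->
  (forall e, 0 < sigma e) -> exists rho, is_extremal p sigma Gamma rho.
Proof.
move=> Gamma_nt p_gt0 sigma_gt0.
have [rho0 rho0_adm] := Adm_neq0 Gamma_nt.
pose bound e := (energy p sigma rho0 / sigma e) `^ p^-1.
pose T := prod_topology (fun _ : edge G => R : topologicalType).
pose box : set T := [set rho : T | forall e, `[0, bound e]%classic (rho e)].
pose lengths : set T := (\bigcap_(gamma in [set: object Gamma])
  [set rho : T | 1 <= \sum_e usage gamma e * rho e]).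
have K_compact : compact (box `&` lengths).
  apply: compact_closedI.
    exact: (@tychonoff (edge G) (fun=> R : topologicalType)
      (fun e => `[0, bound e]%classic) (fun e => @segment_compact R 0 (bound e))).
  by apply: closed_bigI => gamma _; exact: closed_length_ge1.
have in_box rho : Adm Gamma rho -> energy p sigma rho <= energy p sigma rho0 ->
    (box `&` lengths) rho.
  move=> [rho_ge0 rho_len] rho_le; split=> [e|gamma _]; last exact: rho_len.
  rewrite /= in_itv/= rho_ge0/=.
  rewrite -[leLHS]powRr1// -(@mulfV _ p) ?gt_eqF// powRrM.
  have ratio_ge0 : 0 <= energy p sigma rho0 / sigma e.
    by rewrite divr_ge0 ?energy_ge0// ltW.
  apply: ge0_ler_powR; rewrite ?nnegrE ?invr_ge0 ?powR_ge0// ?(ltW p_gt0)//.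
  rewrite ler_pdivlMr// mulrC; apply: le_trans rho_le.
  rewrite /energy (bigD1 e)//= lerDl sumr_ge0// => e' _.
  by rewrite mulr_ge0 ?powR_ge0 ?ltW.
(* The coordinates of an arbitrary point of T may be negative, hence the norm. *)
have energy_cont : continuous
    (fun rho : T => \sum_e sigma e * (`|rho e| `^ p) : R).
  apply: continuous_linear_combination => e rho.
  exact: (continuous_comp (@proj_continuous _ _ e rho)
    (continuous_norm_powR p_gt0 (x := proj e rho))).
have energyE rho : (forall e, 0 <= rho e) ->
    \sum_e sigma e * (`|rho e| `^ p) = energy p sigma rho.
  by move=> rho_ge0; apply: eq_bigr => e _; rewrite ger0_norm.
have K_ge0 rho : (box `&` lengths) rho -> forall e, 0 <= rho e.
  by move=> [rho_box _] e; have := rho_box e; rewrite /= in_itv => /andP[].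
have K_neq0 : (box `&` lengths !=set0).
  by exists rho0; exact: in_box.
have [rho /set_mem rho_K rho_min] := compact_EVT_min K_neq0 K_compact
  (continuous_subspaceT energy_cont).
have rho_adm : Adm Gamma rho.
  by split; [exact: K_ge0|move=> gamma; exact: rho_K.2].
have rho_le rho' : (box `&` lengths) rho' ->
    energy p sigma rho <= energy p sigma rho'.
  move=> rho'_K; have := rho_min rho' (mem_set rho'_K).
  by rewrite !energyE//; exact: K_ge0.
exists rho; split=> //; apply/eqP; rewrite eq_le Mod_le_energy// andbT.
apply: lb_le_inf; first by exists (energy p sigma rho0), rho0.
move=> _ [rho' rho'_adm <-].
have [le_rho0|/ltW ge_rho0] := leP (energy p sigma rho') (energy p sigma rho0).
  exact/rho_le/in_box.
by apply: le_trans ge_rho0; exact/rho_le/in_box.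
Qed.

Lemma extremal_densityP sigma : nontrivial Gamma -> 0 < p ->
  (forall e, 0 < sigma e) ->
  is_extremal p sigma Gamma (extremal_density p sigma Gamma).
Proof.
move=> Gamma_nt p_gt0 sigma_gt0; apply: xgetPex.
exact: is_extremal_exists.
Qed.

Lemma Mod_gt0 sigma : nontrivial Gamma -> 0 < p -> (forall e, 0 < sigma e) ->
  0 < Mod p sigma Gamma.
Proof.
move=> Gamma_nt p_gt0 sigma_gt0.
have [[rho_ge0 rho_len] <-] := extremal_densityP Gamma_nt p_gt0 sigma_gt0.
set rho := extremal_density _ _ _ in rho_ge0 rho_len *.
rewrite lt0r energy_ge0// andbT; apply/eqP => energy0.
have rho0 e : rho e = 0.
  have terms_ge0 e' : true -> 0 <= sigma e' * rho e' `^ p.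
    by rewrite mulr_ge0 ?powR_ge0 ?ltW.
  have /(_ e isT)/eqP := psumr_eq0P terms_ge0 energy0.
  by rewrite mulf_eq0 gt_eqF//= powR_eq0 => /andP[/eqP].
have [gamma _] := card_gt0P Gamma_nt.1.
have := rho_len gamma; rewrite big1 ?ler10// => e _.
by rewrite rho0 mulr0.
Qed.

(** * Comparison of two weights *)

Lemma le_Mod sigma1 sigma2 : nontrivial Gamma ->
  (forall e, 0 < sigma1 e) -> (forall e, sigma1 e <= sigma2 e) ->
  Mod p sigma1 Gamma <= Mod p sigma2 Gamma.
Proof.
move=> Gamma_nt sigma1_gt0 sigma12.
have [rho0 rho0_adm] := Adm_neq0 Gamma_nt.
apply: lb_le_inf; first by exists (energy p sigma2 rho0), rho0.
move=> _ [rho rho_adm <-]; apply: le_trans (Mod_le_energy sigma1_gt0 rho_adm) _.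
by apply: ler_sum => e _; rewrite ler_wpM2r ?powR_ge0.
Qed.

(** Each of the two extremal densities is a competitor in the minimization
problem of the other; the sum of the two inequalities is the claim. *)
Lemma extremal_power_antimonotone sigma1 sigma2 rho1 rho2 :
  (forall e, 0 < sigma1 e) -> (forall e, 0 < sigma2 e) ->
  is_extremal p sigma1 Gamma rho1 -> is_extremal p sigma2 Gamma rho2 ->
  \sum_e (sigma2 e - sigma1 e) * (rho2 e `^ p - rho1 e `^ p) <= 0.
Proof.
move=> sigma1_gt0 sigma2_gt0 [adm1 ext1] [adm2 ext2].
have := Mod_le_energy sigma1_gt0 adm2; rewrite -ext1.
have := Mod_le_energy sigma2_gt0 adm1; rewrite -ext2.
have -> : \sum_e (sigma2 e - sigma1 e) * (rho2 e `^ p - rho1 e `^ p) =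
    (energy p sigma2 rho2 - energy p sigma2 rho1) +
    (energy p sigma1 rho1 - energy p sigma1 rho2).
  by rewrite /energy -!sumrB -big_split/=; apply: eq_bigr => e _; ring.
lra.
Qed.

(** Move from rho towards rho' by the fraction s.  The energy does not decrease,
and its variation is at most p * s * slope s by the tangent inequality taken at
the moved density; hence slope s >= 0 for small positive s.  Taking the tangent
there, and letting s tend to 0 by continuity, avoids differentiating the power
at the coordinates where rho vanishes. *)
Lemma extremal_first_order sigma rho rho' : 1 < p -> (forall e, 0 < sigma e) ->
  is_extremal p sigma Gamma rho -> Adm Gamma rho' ->
  Mod p sigma Gamma <= \sum_e sigma e * rho e `^ (p - 1) * rho' e.
Proof.
move=> p_gt1 sigma_gt0 [rho_adm rho_ext] rho'_adm.
pose y s e := rho e + s * (rho' e - rho e).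
pose slope (s : R) : R :=
  \sum_e sigma e * (rho' e - rho e) * (`|y s e| `^ (p - 1)).
have slope_ge0 s : 0 < s -> s <= 1 -> 0 <= slope s.
  move=> s_gt0 s_le1.
  have y_adm : Adm Gamma (y s) by apply: Adm_convex; rewrite ?(ltW s_gt0).
  have : energy p sigma (y s) - energy p sigma rho <= p * s * slope s.
    rewrite /energy /slope -sumrB mulr_sumr; apply: ler_sum => e _.
    have ye_ge0 := y_adm.1 e.
    have := powR_tangent p_gt1 (rho_adm.1 e) ye_ge0.
    rewrite (ger0_norm ye_ge0).
    have -> : rho e - y s e = - (s * (rho' e - rho e)) by rewrite /y; ring.
    move=> tangent; rewrite -mulrBr -subr_ge0.
    have -> : p * s * (sigma e * (rho' e - rho e) * y s e `^ (p - 1)) -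
        sigma e * (y s e `^ p - rho e `^ p) =
      sigma e * (rho e `^ p - y s e `^ p -
        p * (y s e `^ (p - 1) * - (s * (rho' e - rho e)))) by ring.
    by rewrite mulr_ge0 ?subr_ge0// ltW.
  have := Mod_le_energy sigma_gt0 y_adm; rewrite -rho_ext => min_y slope_y.
  have ps_gt0 : 0 < p * s by rewrite mulr_gt0//; lra.
  by rewrite -(pmulr_rge0 _ ps_gt0); lra.
have slope_cont : continuous slope.
  apply: continuous_linear_combination => e s.
  apply: (@continuous_comp _ _ _ (fun s => y s e)
    (fun z : R => `|z| `^ (p - 1))).
    by apply: cvgD; [exact: cvg_cst|apply: cvgM => //; exact: cvg_cst].
  by apply: continuous_norm_powR; lra.
have slope0_ge0 : 0 <= slope 0.
  have slope_cvg : (slope s @[s --> 0^'+] --> slope 0).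
    by apply: cvg_at_right_filter; exact: slope_cont.
  rewrite -(cvg_lim _ slope_cvg)//.
  apply: limr_ge; first by apply/cvg_ex; exists (slope 0).
  near=> s; apply: slope_ge0; near: s; first exact: nbhs_right_gt.
  exact: nbhs_right_le.
rewrite -rho_ext -subr_ge0; apply: le_trans slope0_ge0 _.
rewrite /slope /energy -sumrB; apply: ler_sum => e _.
rewrite /y mul0r addr0 ger0_norm ?rho_adm.1//.
rewrite -(@mulr_powRB1 _ (rho e) p) ?rho_adm.1//; last by lra.
by rewrite le_eqVlt; apply/orP; left; apply/eqP; ring.
Unshelve. all: by end_near. Qed.

(** The density eta of the statement, for an arbitrary rho in place of the
chosen extremal density. *)
Definition dual_density sigma rho (e : edge G) : R :=
  sigma e * rho e `^ (p - 1) / Mod p sigma Gamma.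

(** After division by the modulus, the first-order condition says that eta is
admissible for the family whose objects are the admissible densities. *)
Lemma dual_density_ge1 sigma rho rho' : nontrivial Gamma -> 1 < p ->
  (forall e, 0 < sigma e) -> is_extremal p sigma Gamma rho ->
  Adm Gamma rho' -> 1 <= \sum_e dual_density sigma rho e * rho' e.
Proof.
move=> Gamma_nt p_gt1 sigma_gt0 rho_ext rho'_adm.
have M_gt0 : 0 < Mod p sigma Gamma by apply: Mod_gt0 => //; lra.
have -> : \sum_e dual_density sigma rho e * rho' e =
    (\sum_e sigma e * rho e `^ (p - 1) * rho' e) / Mod p sigma Gamma.
  by rewrite mulr_suml; apply: eq_bigr => e _; rewrite mulrAC.
by rewrite ler_pdivlMr// mul1r; exact: extremal_first_order.
Qed.

Lemma dual_density_eq1 sigma rho : nontrivial Gamma -> 1 < p ->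
  (forall e, 0 < sigma e) -> is_extremal p sigma Gamma rho ->
  \sum_e dual_density sigma rho e * rho e = 1.
Proof.
move=> Gamma_nt p_gt1 sigma_gt0 [[rho_ge0 _] rho_ext].
have M_gt0 : 0 < Mod p sigma Gamma by apply: Mod_gt0 => //; lra.
have -> : \sum_e dual_density sigma rho e * rho e =
    energy p sigma rho / Mod p sigma Gamma.
  rewrite /energy mulr_suml; apply: eq_bigr => e _.
  rewrite -(@mulr_powRB1 _ (rho e) p)//; last by lra.
  by rewrite /dual_density; ring.
by rewrite rho_ext mulfV ?gt_eqF.
Qed.

(** The sum splits into c2 times the excess of the eta1-length of rho2 over its
eta2-length, which is 1, and c1 times the same with the indices exchanged. *)
Lemma dual_density_cross sigma1 sigma2 rho1 rho2 c1 c2 :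
  nontrivial Gamma -> 1 < p ->
  (forall e, 0 < sigma1 e) -> (forall e, 0 < sigma2 e) ->
  is_extremal p sigma1 Gamma rho1 -> is_extremal p sigma2 Gamma rho2 ->
  0 <= c1 -> 0 <= c2 ->
  0 <= \sum_e (dual_density sigma1 rho1 e - dual_density sigma2 rho2 e) *
              (c2 * rho2 e - c1 * rho1 e).
Proof.
move=> Gamma_nt p_gt1 sigma1_gt0 sigma2_gt0 ext1 ext2 c1_ge0 c2_ge0.
set eta1 := dual_density sigma1 rho1; set eta2 := dual_density sigma2 rho2.
have -> : \sum_e (eta1 e - eta2 e) * (c2 * rho2 e - c1 * rho1 e) =
    c2 * ((\sum_e eta1 e * rho2 e) - \sum_e eta2 e * rho2 e) +
    c1 * ((\sum_e eta2 e * rho1 e) - \sum_e eta1 e * rho1 e).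
  rewrite -!sumrB !mulr_sumr -big_split/=.
  by apply: eq_bigr => e _; ring.
rewrite !dual_density_eq1// addr_ge0// mulr_ge0// subr_ge0.
  by apply: dual_density_ge1 => //; exact: ext2.1.
by apply: dual_density_ge1 => //; exact: ext1.1.
Qed.

(** The scaling of rho for which the modulus disappears from eta, so that the
values of eta for two different weights can be compared edge by edge. *)
Lemma dual_densityE sigma rho : nontrivial Gamma -> 1 < p ->
  (forall e, 0 < sigma e) -> (forall e, 0 <= rho e) -> forall e,
  dual_density sigma rho e =
    sigma e * (Mod p sigma Gamma `^ (- (p - 1)^-1) * rho e) `^ (p - 1).
Proof.
move=> Gamma_nt p_gt1 sigma_gt0 rho_ge0 e.
have M_gt0 : 0 < Mod p sigma Gamma by apply: Mod_gt0 => //; lra.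
rewrite powRM ?powR_ge0// -powRrM mulNr mulVf; last by rewrite gt_eqF//; lra.
by rewrite powR_inv1 ?ltW// /dual_density; ring.
Qed.

End Modulus.

(** * Weights that differ on a single edge *)

Section OneEdge.
Context (R : realType) (G : fin_graph) (Gamma : object_family R G) (p : R).
Context (sigma1 sigma2 : edge G -> R) (e : edge G).
Hypotheses (Gamma_nt : nontrivial Gamma) (p_gt1 : 1 < p).
Hypotheses (sigma1_gt0 : forall e', 0 < sigma1 e').
Hypotheses (sigma2_gt0 : forall e', 0 < sigma2 e').
Hypothesis sigma12_off : forall e', e' != e -> sigma1 e' = sigma2 e'.
Hypothesis sigma12_lt : sigma1 e < sigma2 e.
Context (rho1 rho2 : edge G -> R).
Hypothesis ext1 : is_extremal p sigma1 Gamma rho1.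
Hypothesis ext2 : is_extremal p sigma2 Gamma rho2.

Lemma extremal_edge_anti : rho2 e <= rho1 e.
Proof.
have := extremal_power_antimonotone sigma1_gt0 sigma2_gt0 ext1 ext2.
rewrite (bigD1 e)//= big1 ?addr0 => [|e' /sigma12_off->]; last first.
  by rewrite subrr mul0r.
rewrite pmulr_rle0 ?subr_gt0// subr_le0; apply: contraTT; rewrite -!ltNge.
apply: gt0_ltr_powR; rewrite ?nnegrE ?ext1.1.1 ?ext2.1.1//.
exact: lt_trans p_gt1.
Qed.

(** Off e the weights agree, and there eta is an increasing function of c * rho,
so the terms of the cross inequality have the wrong sign; the term at e must
compensate for them.  If eta decreased at e, then c * rho would not decrease
there, and, since sigma increases, neither would eta. *)
Lemma dual_edge_mono :
  dual_density Gamma p sigma1 rho1 e <= dual_density Gamma p sigma2 rho2 e.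
Proof.
pose c sigma := Mod p sigma Gamma `^ (- (p - 1)^-1).
have c_ge0 sigma : 0 <= c sigma by exact: powR_ge0.
have p1_gt0 : 0 < p - 1 by rewrite subr_gt0.
have x1_ge0 e' : 0 <= c sigma1 * rho1 e' by rewrite mulr_ge0// ext1.1.1.
have x2_ge0 e' : 0 <= c sigma2 * rho2 e' by rewrite mulr_ge0// ext2.1.1.
have eta1E := dual_densityE Gamma_nt p_gt1 sigma1_gt0 ext1.1.1.
have eta2E := dual_densityE Gamma_nt p_gt1 sigma2_gt0 ext2.1.1.
have := dual_density_cross Gamma_nt p_gt1 sigma1_gt0 sigma2_gt0 ext1 ext2
  (c_ge0 sigma1) (c_ge0 sigma2).
rewrite (bigD1 e)//=.
set at_e := (X in X + _); set off_e := (X in _ + X) => sum_ge0.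
have off_e_le0 : off_e <= 0.
  apply: sumr_le0 => e' e'_neq; rewrite eta1E eta2E sigma12_off// -mulrBr.
  rewrite -mulrA pmulr_rle0//.
  have powR_mono := ge0_ler_powR (ltW p1_gt0).
  have [x12|/ltW x21] := leP (c sigma1 * rho1 e') (c sigma2 * rho2 e').
    by rewrite mulr_le0_ge0 ?subr_le0 ?subr_ge0// powR_mono ?nnegrE.
  by rewrite mulr_ge0_le0 ?subr_le0 ?subr_ge0// powR_mono ?nnegrE.
have at_e_ge0 : 0 <= at_e by rewrite (le_trans sum_ge0)// gerDl.
rewrite leNgt; apply/negP => eta21; move: at_e_ge0.
rewrite /at_e pmulr_rge0 ?subr_gt0// subr_ge0 => x12.
move: eta21; rewrite ltNge => /negP; apply; rewrite eta1E eta2E.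
apply: ler_pM; rewrite ?powR_ge0 ?(ltW (sigma1_gt0 e)) ?(ltW sigma12_lt)//.
by apply: ge0_ler_powR; rewrite ?nnegrE// ltW.
Qed.

End OneEdge.

Theorem theorem7p3 (R : realType) (G : fin_graph) (Gamma : object_family R G)
    (p : R) (sigma : edge G -> R) (e : edge G)
    (Gamma_nontrivial : nontrivial Gamma) (p_gt1 : 1 < p)
    (sigma_gt0 : forall e', 0 < sigma e') :
  [/\ {in `]0, +oo[ &, nondecreasing_fun
        (fun t : R => Mod p (set_weight sigma e t) Gamma)},
      {in `]0, +oo[ &, nonincreasing_fun
        (fun t : R => extremal_density p (set_weight sigma e t) Gamma e)} &
      {in `]0, +oo[ &, nondecreasing_fun
        (fun t : R => eta_star p (set_weight sigma e t) Gamma e)}].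
Proof.
have p_gt0 : 0 < p by lra.
have weight_gt0 t : t \in `]0, +oo[ -> forall e', 0 < set_weight sigma e t e'.
  by rewrite in_itv/= andbT => t_gt0 e'; rewrite /set_weight; case: ifP.
have weight_off t1 t2 e' : e' != e ->
    set_weight sigma e t1 e' = set_weight sigma e t2 e'.
  by rewrite /set_weight => /negPf->.
have weight_lt t1 t2 : t1 < t2 ->
    set_weight sigma e t1 e < set_weight sigma e t2 e.
  by rewrite /set_weight eqxx.
have ext t : t \in `]0, +oo[ -> is_extremal p (set_weight sigma e t) Gamma
    (extremal_density p (set_weight sigma e t) Gamma).
  by move=> /weight_gt0; exact: extremal_densityP.
split=> t1 t2 t1_in t2_in.
- move=> t12; apply: le_Mod => // [|e']; first exact: weight_gt0.
  by rewrite /set_weight; case: ifP.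
- rewrite le_eqVlt => /predU1P[->//|t12].
  exact: (extremal_edge_anti p_gt1 (weight_gt0 _ t1_in) (weight_gt0 _ t2_in)
    (weight_off t1 t2) (weight_lt _ _ t12) (ext _ t1_in) (ext _ t2_in)).
- rewrite le_eqVlt => /predU1P[->//|t12].
  exact: (dual_edge_mono Gamma_nontrivial p_gt1 (weight_gt0 _ t1_in)
    (weight_gt0 _ t2_in) (weight_off t1 t2) (weight_lt _ _ t12)
    (ext _ t1_in) (ext _ t2_in)).
Qed.
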